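(* Let $k\geqslant 2$ be an integer, and let $\varepsilon,\sigma,\eta>0$ satisfy \[ \varepsilon\leqslant 1-\frac{1}{2k},\qquad \sigma\leqslant \frac{\varepsilon^{k-1}}{2k},\qquad \eta\leqslant \frac{\sigma}{4^{k-1}}. \] Let $A$ be a set with $|A|=k$, let $n\geqslant k$ be an integer, and let $\langle D_t:t\in A^n\rangle$ be an $\eta$-stationary (with respect to combinatorial lines) stochastic process in a probability space $(\Omega,\mathcal{F},\mathbb{P})$ such that $|\mathbb{P}(D_t)-\varepsilon|\leqslant \eta$ for every $t\in A^n$. Then at least one of the following holds. \begin{enumerate} \item[(i)] For every combinatorial line $L$ of $A^n$ and every nonempty $G\subseteq L$ we have $\big|\mathbb{P}\big(\bigcap_{t\in G}D_t\big)-\varepsilon^{|G|}\big|\leqslant\sigma$. \item[(ii)] There exist a nonempty subset $\Gamma$ of $A$, an element $\beta\in A\setminus\Gamma$ and a stochastic process $\langle S_t:t\in A^n\rangle$ in $(\Omega,\mathcal{F},\mathbb{P})$ such that: (a) for every $t\in A^n$ we have $S_t=\bigcap_{\alpha\in\Gamma}E^\alpha_t$, where for every $\alpha\in\Gamma$ the process $\langle E^\alpha_t:t\in A^n\rangle$ (of events in $\mathcal{F}$) is $(\alpha,\beta)$-insensitive; and (b) for every $t\in A^n$ which contains $\beta$ (i.e. some coordinate of $t$ equals $\beta$) we have \[ \mathbb{P}(S_t)\geqslant\frac{\varepsilon^{k-1}}{4k}\quad\text{and}\quad \mathbb{P}(D_t\,|\,S_t)\geqslant \varepsilon+\frac{\sigma}{4^{k-1}}.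 \] \end{enumerate}
   Context: For a finite set $A$ with $|A|\geqslant 2$ and a positive integer $n$, $A^n$ is the set of sequences of length $n$ with values in $A$. A stochastic process $\langle D_t:t\in A^n\rangle$ is a family of events in the probability space. Fix a letter $x\notin A$. A variable word over $A$ of length $n$ is a sequence of length $n$ with values in $A\cup\{x\}$ in which $x$ appears at least once; for $\alpha\in A$, $v(\alpha)\in A^n$ is obtained by replacing every occurrence of $x$ in $v$ by $\alpha$. A combinatorial line of $A^n$ is a set $\{v(\alpha):\alpha\in A\}$ with $v$ a variable word over $A$ of length $n$. A process $\langle D_t:t\in A^n\rangle$ is $\eta$-stationary (with respect to combinatorial lines) if for every nonempty $\Gamma\subseteq A$ and every pair $v_1,v_2$ of variable words over $A$ of length $n$, $\big|\mathbb{P}\big(\bigcap_{\alpha\in\Gamma}D_{v_1(\alpha)}\big)-\mathbb{P}\big(\bigcap_{\alpha\in\Gamma}D_{v_2(\alpha)}\big)\big|\leqslant\eta$. For $\alpha\neq\beta$ in $A$, two elements $s=(s_1,\dots,s_n),t=(t_1,\dots,t_n)$ of $A^n$ are $(\alpha,\beta)$-equivalent if for every $i\in[n]$ and every $\gamma\in A\setminus\{\alpha,\beta\}$ we have $s_i=\gamma$ iff $t_i=\gamma$. A process $\langle E_t:t\in A^n\rangle$ is $(\alpha,\beta)$-insensitive if $E_s=E_t$ whenever $s,t$ are $(\alpha,\beta)$-equivalent. $\mathbb{P}(D\,|\,S)=\mathbb{P}(D\cap S)/\mathbb{P}(S)$. *)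

(* Defs.v *)
From HB Require Import structures.
From mathcomp Require Import all_boot all_order all_algebra.
From mathcomp Require Import all_classical all_reals all_analysis.

Set Implicit Arguments.
Unset Strict Implicit.
Unset Printing Implicit Defensive.

Import Order.TTheory GRing.Theory Num.Theory.

Local Open Scope classical_set_scope.
Local Open Scope ring_scope.

Section Words.
Variables (A : finType) (n : nat).

(* A word over A together with the extra letter x is an n-tuple over option A:
   Some a encodes the letter a, and None encodes x. *)
Definition variable_word (v : n.-tuple (option A)) : bool := None \in v.

Definition word_subst (v : n.-tuple (option A)) (a : A) : n.-tuple A :=
  map_tuple (odflt a) v.

Definition combinatorial_line (L : {set n.-tuple A}) : Prop :=
  exists2 v : n.-tuple (option A),
    variable_word v & L = [set word_subst v a | a : A]%SET.

Definition letter_equivalent (a b : A) (s t : n.-tuple A) : Prop :=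
  forall (i : 'I_n) (c : A), c != a -> c != b ->
    (tnth s i = c <-> tnth t i = c).

Definition insensitive (T : Type) (a b : A) (E : n.-tuple A -> set T) : Prop :=
  forall s t : n.-tuple A, letter_equivalent a b s t -> E s = E t.

End Words.

Section Processes.
Context (d : measure_display) (Omega : measurableType d) (R : realType).
Variables (P : probability Omega R) (A : finType) (n : nat).

Definition pr (X : set Omega) : R := fine (P X).

(* Equals 0 when pr S = 0. *)
Definition cond_pr (X S : set Omega) : R := pr (X `&` S) / pr S.

Definition stochastic_process (D : n.-tuple A -> set Omega) : Prop :=
  forall t : n.-tuple A, measurable (D t).

Definition stationary (eta : R) (D : n.-tuple A -> set Omega) : Prop :=
  forall Gamma : {set A}, Gamma != finset.set0 ->
  forall v1 v2 : n.-tuple (option A), variable_word v1 -> variable_word v2 ->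
    `|pr (\bigcap_(a in [set` Gamma]) D (word_subst v1 a))
      - pr (\bigcap_(a in [set` Gamma]) D (word_subst v2 a))| <= eta.

End Processes.

(* Main.v *)
Require Import Defs.
From HB Require Import structures.
From mathcomp Require Import all_boot all_order all_algebra.
From mathcomp Require Import all_classical all_reals all_analysis.
From mathcomp Require Import lra zify.

Set Implicit Arguments.
Unset Strict Implicit.

Import Order.TTheory GRing.Theory Num.Theory.
Local Open Scope classical_set_scope.
Local Open Scope ring_scope.

(** Put [u = sigma / 4 ^ (k - 1)].  Unless (ii) holds, induction on [m = #|G|]
    shows that [P (\bigcap_(a in G) D (v a))] is within [4 ^ (m - 1) * u] of
    [eps ^ m] for all variable words [v] and all sets of letters [G]; as
    [m <= k], this is (i).  If the bound first fails at [G], fix [b] in [G].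
    When the intersection is too large, [D (v b)] is positively correlated with
    the intersection over [G :\ b].  When it is too small, fix also [c] in
    [G :\ b]: then [D (v b)] is positively correlated with the difference of the
    intersection over [G :\ b :\ c] and [D (v c)].  Stationarity transfers the
    failure to all variable words, and any [t] containing [b] is [v b] for the
    word [v] in which each [b] of [t] has become the variable; replacing [b] by
    [a] in [t] does not distinguish [(a, b)]-equivalent words. *)

(** * Replacing a letter in a word, and the variable word behind it *)

Section Replacement.
Variables (A : finType) (n : nat).
Implicit Types (t : n.-tuple A) (v : n.-tuple (option A)).

Definition letter_replace (b a : A) t : n.-tuple A :=
  map_tuple (fun c => if c == b then a else c) t.

Definition abstract_letter (b : A) t : n.-tuple (option A) :=
  map_tuple (fun c => if c == b then None else Some c) t.

Lemma letter_replace_id b t : letter_replace b b t = t.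
Proof.
by apply: eq_from_tnth => i; rewrite tnth_map; case: eqP.
Qed.

Lemma word_subst_abstract b a t :
  word_subst (abstract_letter b t) a = letter_replace b a t.
Proof.
by apply: eq_from_tnth => i; rewrite !tnth_map; case: eqP.
Qed.

Lemma abstract_letter_variable b t :
  b \in t -> variable_word (abstract_letter b t).
Proof.
by move=> bt; apply/mapP; exists b => //; rewrite eqxx.
Qed.

(** Equivalent words agree wherever a letter other than [a] and [b] occurs, and the replacement
    merges [a] and [b] at the remaining positions. *)
Lemma letter_replace_equivalent a b s t :
  letter_equivalent a b s t -> letter_replace b a s = letter_replace b a t.
Proof.
move=> st; apply: eq_from_tnth => i; rewrite !tnth_map.
have [sb|sb] := eqVneq (tnth s i) b; have [tb|tb] := eqVneq (tnth t i) b => //.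
- have [//|ta] := eqVneq (tnth t i) a.
  by case/eqP: (tb); rewrite -sb (st i _ ta tb).2.
- have [//|sa] := eqVneq (tnth s i) a.
  by case/eqP: (sb); rewrite -tb (st i _ sa sb).1.
have [sa|sa] := eqVneq (tnth s i) a; last by have /(_ erefl) := (st i _ sa sb).1.
have [ta|ta] := eqVneq (tnth t i) a; first by rewrite sa ta.
by have /(_ erefl) := (st i _ ta tb).2.
Qed.

(** Any position of the variable displays the substituted letter. *)
Lemma word_subst_inj v : variable_word v -> injective (word_subst v).
Proof.
move=> /tnthP[i vi] a b /(congr1 (fun t => tnth t i)).
by rewrite !tnth_map -vi.
Qed.

End Replacement.

(** * Intersections of events indexed by a set of letters *)

Section Intersections.
Variables (T : Type) (A : finType).
Implicit Types (F : A -> set T) (G : {set A}).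

Lemma bigcap_finset0 F :
  \bigcap_(a in [set` (finset.set0 : {set A})]) F a = setT.
Proof.
by apply/seteqP; split=> // x _ a /=; rewrite inE.
Qed.

Lemma bigcap_finset1 F b : \bigcap_(a in [set` [set b]%SET]) F a = F b.
Proof.
apply/seteqP; split=> x.
  by apply; rewrite /= inE.
by move=> Fb a /=; rewrite inE => /eqP ->.
Qed.

Lemma bigcap_finsetD1 F G b : b \in G ->
  \bigcap_(a in [set` G]) F a = F b `&` \bigcap_(a in [set` (G :\ b)%SET]) F a.
Proof.
move=> bG; apply/seteqP; split=> x.
  move=> Fx; split; first exact: Fx.
  by move=> a /=; rewrite in_setD1 => /andP[_ aG]; exact: Fx.
move=> [Fb Fx] a /= aG; have [->//|ab] := eqVneq a b.
by apply: Fx; rewrite /= in_setD1 ab.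
Qed.

Lemma bigcap_imset (I : finType) (f : A -> I) (F : I -> set T) G :
  \bigcap_(i in [set` (f @: G)%SET]) F i = \bigcap_(a in [set` G]) F (f a).
Proof.
apply/seteqP; split=> x Fx a /=.
  by move=> aG; apply: Fx; apply/imset_f.
by move=> /imsetP[b bG ->]; exact: Fx.
Qed.

(** Presents the event measured in the too small case as a nested difference, so that its
    probability is a difference of two probabilities. *)
Lemma setD_bigcap_finsetD1 F G b c : b \in G -> c \in (G :\ b)%SET ->
  F b `&` (\bigcap_(a in [set` (G :\ b :\ c)%SET]) F a `\` F c)
  = \bigcap_(a in [set` (G :\ c)%SET]) F a `\`
    \bigcap_(a in [set` G]) F a.
Proof.
move=> bG; rewrite in_setD1 => /andP[cb cG].
have bGc : b \in (G :\ c)%SET by rewrite in_setD1 eq_sym cb.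
rewrite (bigcap_finsetD1 F cG) (bigcap_finsetD1 F bGc) finset.setDDl.
rewrite finset.setUC -finset.setDDl.
by apply/seteqP; split=> x /=; tauto.
Qed.

End Intersections.

(** * Real-valued probabilities and conditioning *)

Section Pr.
Context (d : measure_display) (Omega : measurableType d) (R : realType).
Variable P : probability Omega R.

Lemma pr_setT : pr P setT = 1.
Proof. by rewrite /pr probability_setT. Qed.

Lemma pr_le1 X : measurable X -> pr P X <= 1.
Proof.
by move=> mX; rewrite -lee_fin fineK ?probability_le1 ?fin_num_measure.
Qed.

Lemma pr_setD X Y : measurable X -> measurable Y -> Y `<=` X ->
  pr P (X `\` Y) = pr P X - pr P Y.
Proof.
move=> mX mY YX; rewrite /pr measureD ?ltey_eq ?fin_num_measure //.
by rewrite (setIidr YX) fineB ?fin_num_measure.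
Qed.

(** Dividing the gain [u] by [pr P S], which is at most 1, cannot shrink it. *)
Lemma cond_pr_ge (e u : R) X S : measurable S -> 0 < pr P S -> 0 <= u ->
  e * pr P S + u <= pr P (X `&` S) -> e + u <= cond_pr P X S.
Proof.
move=> mS S0 u0; rewrite ler_pdivlMr//; apply: le_trans.
by rewrite mulrDl lerD2l ler_piMr// pr_le1.
Qed.

End Pr.

(** * Numerical estimates for the induction *)

Section Threshold.
Variables (R : realType) (k : nat) (sigma : R).
Hypotheses (k_ge2 : (2 <= k)%N) (sigma_gt0 : 0 < sigma).

Let u := sigma / 4 ^+ (k - 1).

(* It vanishes at [0] because the empty intersection is the whole space. *)
Definition threshold (j : nat) : R := if j is i.+1 then 4 ^+ i * u else 0.

Let u_gt0 : 0 < u.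
Proof. by rewrite divr_gt0// exprn_gt0. Qed.

Lemma threshold_ge0 j : 0 <= threshold j.
Proof. by case: j => //= j; rewrite mulr_ge0 ?exprn_ge0 ?ltW. Qed.

Lemma threshold_ge j : u <= threshold j.+1.
Proof. by rewrite /= ler_peMl ?(ltW u_gt0)// exprn_ege1// ler1n. Qed.

Lemma threshold_step j : threshold j.+2 = 4 * threshold j.+1.
Proof. by rewrite /= exprS mulrA. Qed.

(** For positive [j] the threshold equals [sigma / 4 ^ (k - j)]. *)
Lemma threshold_le_div j i : (0 < k - i)%N -> (j <= k - i)%N ->
  threshold j <= sigma / 4 ^+ i.
Proof.
case: j => [|j] /= ki ji; first by rewrite divr_ge0 ?exprn_ge0 ?ltW.
rewrite /u mulrCA ler_pM2l// ler_pdivrMr ?exprn_gt0// mulrC.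
by rewrite ler_pdivlMr ?exprn_gt0// -exprD ler_weXn2l ?ler1n//; lia.
Qed.

Lemma threshold_le j : (j <= k)%N -> threshold j <= sigma.
Proof.
move=> jk; have := @threshold_le_div j 0.
by rewrite subn0 expr0 divr1; apply => //; apply: leq_trans k_ge2.
Qed.

Variable eps : R.
Hypotheses (eps_gt0 : 0 < eps) (heps : eps <= 1 - 1 / (2 * k%:R))
  (hsigma : sigma <= eps ^+ (k - 1) / (2 * k%:R)).

Let k2_gt0 : 0 < 2 * k%:R :> R.
Proof. by rewrite mulr_gt0 ?ltr0n//; apply: leq_trans k_ge2. Qed.

Let kinv_gt0 : 0 < (2 * k%:R)^-1 :> R.
Proof. by rewrite invr_gt0. Qed.

Let kinv_le : (2 * k%:R)^-1 <= 1 / 4 :> R.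
Proof.
rewrite -[1 / 4]/(1 * 4^-1) mul1r lef_pV2 ?posrE//.
by have : 2 <= k%:R :> R; [rewrite ler_nat|lra].
Qed.

Lemma eps_le : eps <= 1 - (2 * k%:R)^-1.
Proof. by move: heps; rewrite mul1r. Qed.

Lemma expr_eps_le i j : (i <= j)%N -> eps ^+ j <= eps ^+ i.
Proof.
move=> ij; apply: ler_wiXn2l => //; first exact: ltW.
by move: kinv_gt0 eps_le; lra.
Qed.

Lemma inv_4k : (4 * k%:R)^-1 = (2 * k%:R)^-1 / 2 :> R.
Proof. by rewrite -invfM; congr (_^-1); lra. Qed.

(** With [e = eps ^ (k - 1)] and [y = 1 / (2 * k) <= 1 / 4], one has [p >= e - sigma >= e * (1 - y)
    >= e * y / 2]. *)
Lemma pr_inter_lower (j : nat) (p : R) : (j < k)%N ->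
  `|p - eps ^+ j| <= threshold j -> eps ^+ (k - 1) / (4 * k%:R) <= p.
Proof.
move=> jk; rewrite ler_norml => /andP[hp _].
have tj : threshold j <= sigma by apply: threshold_le; apply: ltnW.
have ej : eps ^+ (k - 1) <= eps ^+ j by apply: expr_eps_le; lia.
have e0 : 0 < eps ^+ (k - 1) by rewrite exprn_gt0.
rewrite inv_4k; move: hsigma kinv_le kinv_gt0.
move: (2 * k%:R)^-1 => y; nra.
Qed.

(** With the same [e] and [y], the main term [eps ^ j * (1 - eps)] is at least [e * y], and the two
    errors, at most [sigma / 4] each, cost at most half of it. This is the source of the constant
    [4 * k]. *)
Lemma pr_diff_lower (j : nat) (p q : R) : (j.+1 < k)%N ->
  `|p - eps ^+ j| <= threshold j -> `|q - eps ^+ j.+1| <= threshold j.+1 ->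
  eps ^+ (k - 1) / (4 * k%:R) <= p - q.
Proof.
move=> jk; rewrite !ler_norml => /andP[hp _] /andP[_ hq].
have t1 : threshold j.+1 <= sigma / 4.
  by rewrite -[4]expr1; apply: threshold_le_div; lia.
have t0 : threshold j <= sigma / 4.
  by rewrite -[4]expr1; apply: threshold_le_div; lia.
have ej : eps ^+ (k - 1) <= eps ^+ j by apply: expr_eps_le; lia.
have e0 : 0 < eps ^+ (k - 1) by rewrite exprn_gt0.
move: hq; rewrite inv_4k exprSr; move: hsigma kinv_le kinv_gt0 eps_le.
move: (2 * k%:R)^-1 => y; nra.
Qed.

(** As [threshold j.+2] is four times [threshold j.+1], three copies of the latter remain after the
    error in [p]; each is at least [u], which pays for both [eta] and the gain. *)
Lemma correlation_pos (j : nat) (p q eta : R) : eta <= u ->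
  `|p - eps ^+ j.+1| <= threshold j.+1 ->
  eps ^+ j.+2 + threshold j.+2 - eta <= q ->
  eps * p + u <= q.
Proof.
move=> hu; rewrite ler_norml threshold_step (exprS _ j.+1) => /andP[_ hp].
have e1 : eps <= 1 by move: kinv_gt0 eps_le; lra.
have : eps * p <= eps * eps ^+ j.+1 + threshold j.+1.
  move: (threshold_ge0 j.+1) hp; move: (threshold _) (_ ^+ j.+1) => t e.
  by move: eps_gt0; nra.
by move: u_gt0 (threshold_ge j); lra.
Qed.

(* [p0], [p1], [q1], [q2] stand for the probabilities of the intersections over
   [G :\ b :\ c], [G :\ b], [G :\ c] and [G]. *)
Lemma correlation_neg (j : nat) (p0 p1 q1 q2 eta : R) : eta <= u ->
  `|p0 - eps ^+ j| <= threshold j ->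
  `|p1 - eps ^+ j.+1| <= threshold j.+1 ->
  `|q1 - eps ^+ j.+1| <= threshold j.+1 ->
  q2 <= eps ^+ j.+2 - threshold j.+2 + eta ->
  eps * (p0 - p1) + u <= q1 - q2.
Proof.
move=> hu; rewrite !ler_norml threshold_step.
move=> /andP[_ h0] /andP[h1 _] /andP[h2 _].
have e1 : eps <= 1 by move: kinv_gt0 eps_le; lra.
have b0 : eps * p0 <= eps ^+ j.+1 + threshold j.
  rewrite exprS; move: (threshold_ge0 j) h0.
  by move: (threshold _) (_ ^+ j) => t e; move: eps_gt0; nra.
have b1 : eps ^+ j.+2 - threshold j.+1 <= eps * p1.
  rewrite (exprS _ j.+1); move: (threshold_ge0 j.+1) h1.
  by move: (threshold _) (_ ^+ j.+1) => t e; move: eps_gt0; nra.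
(* Exactly the slack that the conclusion needs, and the reason for the ratio 4: at [j = 0] it is an
   equality, since [threshold] is 0 at 0 and [u] at 1. *)
have b : threshold j + 2 * u <= 2 * threshold j.+1.
  case: j {h0 h1 h2 b0 b1} => [|j]; first by rewrite /= expr0; lra.
  by rewrite threshold_step; move: u_gt0 (threshold_ge j); lra.
by move: u_gt0 (threshold_ge j); lra.
Qed.

End Threshold.

(** * The dichotomy, by induction on the number of letters *)

Unset Implicit Arguments.

Theorem theorem1p5 (R : realType) (k : nat) (hk : (2 <= k)%N)
  (eps sigma eta : R) (eps_gt0 : 0 < eps) (sigma_gt0 : 0 < sigma)
  (eta_gt0 : 0 < eta)
  (heps : eps <= 1 - 1 / (2 * k%:R))
  (hsigma : sigma <= eps ^+ (k - 1) / (2 * k%:R))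
  (heta : eta <= sigma / 4 ^+ (k - 1))
  (A : finType) (hA : #|A| = k) (n : nat) (hn : (k <= n)%N)
  (d : measure_display) (Omega : measurableType d) (P : probability Omega R)
  (D : n.-tuple A -> set Omega) (D_process : stochastic_process D)
  (D_stationary : stationary P eta D)
  (D_eps : forall t : n.-tuple A, `|pr P (D t) - eps| <= eta) :
  (forall L : {set n.-tuple A}, combinatorial_line L ->
   forall G : {set n.-tuple A}, G != finset.set0 -> G \subset L ->
     `|pr P (\bigcap_(t in [set` G]) D t) - eps ^+ #|G| | <= sigma)
  \/
  (exists (Gamma : {set A}) (beta : A) (S : n.-tuple A -> set Omega),
    [/\ Gamma != finset.set0, beta \notin Gamma, stochastic_process S,
      (exists E : A -> n.-tuple A -> set Omega,
        (forall alpha : A, alpha \in Gamma ->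
          stochastic_process (E alpha) /\ insensitive alpha beta (E alpha)) /\
        (forall t : n.-tuple A,
          S t = \bigcap_(alpha in [set` Gamma]) E alpha t)) &
      (forall t : n.-tuple A, beta \in t ->
        eps ^+ (k - 1) / (4 * k%:R) <= pr P (S t) /\
        eps + sigma / 4 ^+ (k - 1) <= cond_pr P (D t) (S t))]).
Proof.
set ii := (X in _ \/ X).
have [|not_ii] := pselect ii; first by right.
left; set u := sigma / 4 ^+ (k - 1).
have u_gt0 : 0 < u by rewrite divr_gt0// exprn_gt0.
pose w v (a : A) := D (word_subst v a).
pose p v (G : {set A}) := pr P (\bigcap_(a in [set` G]) w v a).
have mw v (G : {set A}) : measurable (\bigcap_(a in [set` G]) w v a).
  by apply: fin_bigcap_measurable => [|a _]; [exact: finite_finset|exact: D_process].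
have lb_gt0 : 0 < eps ^+ (k - 1) / (4 * k%:R).
  by rewrite divr_gt0 ?exprn_gt0// mulr_gt0// ltr0n; lia.
(* Strong induction: size [m.+2] calls on size [m.+1] and, in the too small case, also on size [m],
   possibly 0. *)
have bound : forall m v (G : {set A}), variable_word v -> #|G| = m ->
    `|p v G - eps ^+ m| <= threshold k sigma m.
  elim/ltn_ind => -[_ v G _ /cards0_eq ->|].
    by rewrite /p bigcap_finset0 pr_setT expr0 subrr normr0.
  case=> [_ v G _ /eqP/cards1P[b ->]|m IH v G vv Gm].
    rewrite /p bigcap_finset1 expr1 /= expr0 mul1r.
    exact: le_trans (D_eps _) heta.
  have [b bG] : exists b, b \in G by apply/card_gt0P; rewrite Gm.
  have Gb : #|G :\ b|%SET = m.+1 by rewrite (cardsD1 b) bG in Gm; case: Gm.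
  have mk : (m.+2 <= k)%N by rewrite -Gm -hA max_card.
  have G0 : G != finset.set0 by rewrite -card_gt0 Gm.
  have stat v' : variable_word v' -> `|p v G - p v' G| <= eta.
    by move=> vv'; exact: D_stationary.
  rewrite leNgt; apply/negP; rewrite ltr_normr => /orP[pos|neg]; apply: not_ii.
  - pose E a t := D (letter_replace b a t).
    exists (G :\ b)%SET, b, (fun t => \bigcap_(a in [set` (G :\ b)%SET]) E a t).
    have EE t : \bigcap_(a in [set` (G :\ b)%SET]) E a t =
        \bigcap_(a in [set` (G :\ b)%SET]) w (abstract_letter b t) a.
      by apply: eq_bigcapr => a _; rewrite /w word_subst_abstract.
    split.
    + by rewrite -card_gt0 Gb.
    + by rewrite !inE eqxx.
    + by move=> t; rewrite EE.
    + exists E; split=> // a _; split=> [t|s t st]; first exact: D_process.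
      by rewrite /E (letter_replace_equivalent st).
    move=> t /abstract_letter_variable; rewrite EE.
    set v' := abstract_letter b t => vv'.
    have h1 := IH m.+1 (ltnSn _) v' (G :\ b)%SET vv' Gb.
    have lb : eps ^+ (k - 1) / (4 * k%:R) <= p v' (G :\ b)%SET.
      exact: (pr_inter_lower hk sigma_gt0 eps_gt0 heps hsigma mk h1).
    split=> //; apply: cond_pr_ge => //; [exact: lt_le_trans lb|exact: ltW|].
    have -> : D t = w v' b by rewrite /w word_subst_abstract letter_replace_id.
    rewrite -bigcap_finsetD1//.
    apply: (correlation_pos hk sigma_gt0 eps_gt0 heps heta h1).
    rewrite -/(p v' G).
    by have := stat _ vv'; rewrite ler_norml => /andP[_]; lra.
  have [c cG] : exists c, c \in (G :\ b)%SET by apply/card_gt0P; rewrite Gb.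
  have Gbc : #|G :\ b :\ c|%SET = m by rewrite (cardsD1 c) cG in Gb; case: Gb.
  have [cb cG'] : c != b /\ c \in G by move: cG; rewrite in_setD1 => /andP.
  have Gc : #|G :\ c|%SET = m.+1 by rewrite (cardsD1 c) cG' in Gm; case: Gm.
  (* Complementing the factor at [c] makes the intersection over [G :\ b] the required difference
     and keeps every factor insensitive. *)
  pose E a t := if a == c then ~` D (letter_replace b a t)
                else D (letter_replace b a t).
  exists (G :\ b)%SET, b, (fun t => \bigcap_(a in [set` (G :\ b)%SET]) E a t).
  have EE t : \bigcap_(a in [set` (G :\ b)%SET]) E a t =
      \bigcap_(a in [set` (G :\ b :\ c)%SET]) w (abstract_letter b t) a
      `\` w (abstract_letter b t) c.
    rewrite (bigcap_finsetD1 _ cG) setDE setIC {2}/E eqxx /w word_subst_abstract.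
    congr (_ `&` _); apply: eq_bigcapr => a /=; rewrite in_setD1 => /andP[ac _].
    by rewrite /E (negbTE ac) word_subst_abstract.
  have mE t : measurable (\bigcap_(a in [set` (G :\ b)%SET]) E a t).
    by rewrite EE; apply: measurableD => //; exact: D_process.
  split=> //.
  + by rewrite -card_gt0 Gb.
  + by rewrite !inE eqxx.
  + exists E; split=> // a _; split=> [t|s t st].
      by rewrite /E; case: ifP => _; [apply: measurableC|]; exact: D_process.
    by rewrite /E (letter_replace_equivalent st).
  move=> t /abstract_letter_variable; have := mE t; rewrite EE.
  set v' := abstract_letter b t => mS vv'.
  have h0 : `|p v' (G :\ b :\ c)%SET - eps ^+ m| <= threshold k sigma m.
    by apply: IH.
  have h1 := IH m.+1 (ltnSn _) v' (G :\ b)%SET vv' Gb.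
  have h2 := IH m.+1 (ltnSn _) v' (G :\ c)%SET vv' Gc.
  (* Removing [w v' c] amounts to removing the intersection over [G :\ b], which is contained in the
     one over [G :\ b :\ c]. *)
  have prS : pr P (\bigcap_(a in [set` (G :\ b :\ c)%SET]) w v' a `\` w v' c) =
      p v' (G :\ b :\ c)%SET - p v' (G :\ b)%SET.
    rewrite -pr_setD// ?(bigcap_finsetD1 _ cG); last by apply: subIsetr.
    by congr (pr P _); apply/seteqP; split=> x /=; tauto.
  have lb : eps ^+ (k - 1) / (4 * k%:R) <=
      p v' (G :\ b :\ c)%SET - p v' (G :\ b)%SET.
    exact: (pr_diff_lower hk sigma_gt0 eps_gt0 heps hsigma mk h0 h1).
  split; first by rewrite prS.
  apply: cond_pr_ge => //; rewrite ?prS; [exact: lt_le_trans lb|exact: ltW|].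
  have -> : D t = w v' b by rewrite /w word_subst_abstract letter_replace_id.
  rewrite setD_bigcap_finsetD1// pr_setD//; last first.
    by rewrite (bigcap_finsetD1 _ cG'); apply: subIsetr.
  apply: (correlation_neg hk sigma_gt0 eps_gt0 heps heta h0 h1 h2).
  rewrite -/(p v' G).
  by have := stat _ vv'; rewrite ler_norml => /andP[+ _]; lra.
move=> L [v vv ->] G G0 GL.
(* A subset of the line is the image of its preimage [H], so [bound] applies to [H], which has as
   many elements as [G]. *)
have [H HG] : exists H : {set A}, G = (word_subst v @: H)%SET.
  exists (word_subst v @^-1: G)%SET; apply/setP => t.
  apply/idP/imsetP => [tG|[a + ->]]; last by rewrite inE.
  have /imsetP[a _ ta] := fintype.subsetP GL t tG.
  by exists a => //; rewrite inE -ta.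
rewrite HG bigcap_imset card_imset; last exact: word_subst_inj.
apply: le_trans (bound _ _ _ vv erefl) _.
by apply: threshold_le => //; rewrite -hA max_card.
Qed.
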